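(* Let $n\ge 3$, let $G$ be the cyclic group $\mathbf{C}_n\subset\mathrm{SU}_2$ and let $V=\mathbb{C}^2=\mathbf{C}_n^{(-1)}\oplus\mathbf{C}_n^{(1)}$. Then the Poincaré series $m^0(t)=\sum_{k\ge0}\dim\bigl((V^{\otimes k})^G\bigr)t^k$ for the $G$-invariants $T(V)^G$ in $T(V)=\bigoplus_{k\ge0}V^{\otimes k}$ is given by $$ m^0(t)=\frac{\prod_{r=1}^{n-1}\left(1-2\cos\left(\frac{\pi r}{n}\right)t\right)}{\prod_{r=0}^{n-1}\left(1-2\cos\left(\frac{2\pi r}{n}\right)t\right)}=\frac{\sum_{r=0}^{\lfloor (n-1)/2\rfloor}(-1)^r\binom{n-1-r}{r}t^{2r}}{2^{1-n}\sum_{r=0}^{\lfloor n/2\rfloor}\binom{n}{2r}(1-4t^2)^r-2t^n}. $$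
   Context: $\mathbf{C}_n$ is the cyclic subgroup of $\mathrm{SU}_2$ (the $2\times2$ complex special unitary matrices) of order $n$ generated by $z=\begin{pmatrix}\zeta_n^{-1}&0\\0&\zeta_n\end{pmatrix}$, where $\zeta_n=e^{2\pi i/n}$. It acts on the space $V=\mathbb{C}^2$ of column vectors by matrix multiplication. $\mathbf{C}_n^{(\ell)}$ denotes the one-dimensional $\mathbf{C}_n$-module on which $z$ acts as multiplication by $\zeta_n^\ell$ (index taken modulo $n$). $V^{\otimes0}=\mathbb{C}$ is the trivial module. The identities hold for formal power series in $t$. *)

(* Defs.v *)
From HB Require Import structures.
From mathcomp Require Import all_boot all_order all_algebra.
From mathcomp Require Import spectral.
From mathcomp Require Import all_classical all_reals all_analysis.
From mathcomp Require Import complex.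

Set Implicit Arguments.
Unset Strict Implicit.
Unset Printing Implicit Defensive.
Import Order.TTheory GRing.Theory Num.Theory.
Local Open Scope classical_set_scope.
Local Open Scope ring_scope.
Local Open Scope complex_scope.

Section TensorPowers.
Variable C : fieldType.

(* The k-th tensor power of the space 'cV[C]_2, in coordinates with respect to
   the basis e_(w 0) (x) ... (x) e_(w (k-1)), for w : 'I_k -> 'I_2. *)
Definition tpow (k : nat) := {ffun {ffun 'I_k -> 'I_2} -> C^o}.

Definition ptens (k : nat) (v : 'I_k -> 'cV[C]_2) : tpow k :=
  [ffun w : {ffun 'I_k -> 'I_2} => \prod_(a < k) v a (w a) ord0].

(* The k-th tensor power of the endomorphism of 'cV[C]_2 with matrix g;
   tact_ptens and tact_unique say that it is the linear map sending
   v_1 (x) ... (x) v_k to g v_1 (x) ... (x) g v_k. *)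
Definition tact (k : nat) (g : 'M[C]_2) (u : tpow k) : tpow k :=
  [ffun w : {ffun 'I_k -> 'I_2} =>
     \sum_(w' : {ffun 'I_k -> 'I_2}) (\prod_(a < k) g (w a) (w' a)) * u w'].

Lemma tact_is_linear k g : linear (@tact k g).
Proof.
move=> c u v; apply/ffunP=> w; rewrite !ffunE /= /GRing.scale /= mulr_sumr -big_split /=.
by apply: eq_bigr => w' _; rewrite !ffunE /= mulrDr mulrCA.
Qed.

Lemma tact_ptens k g (v : 'I_k -> 'cV[C]_2) :
  tact g (ptens v) = ptens (fun a => g *m v a).
Proof.
apply/ffunP=> w; rewrite !ffunE.
under [RHS]eq_bigr do rewrite mxE.
rewrite bigA_distr_bigA /=; apply: eq_bigr => w' _.
by rewrite ffunE -big_split.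
Qed.

Lemma tpow_decomp k (u : tpow k) :
  u = \sum_w u w *: ptens (fun a => delta_mx (w a) ord0).
Proof.
apply/ffunP=> w; rewrite sum_ffunE (bigD1 w) //= !ffunE.
rewrite big1 => [|a _]; last by rewrite mxE !eqxx.
rewrite big1 => [|w' w'w]; first by rewrite addr0 /GRing.scale /= mulr1.
rewrite !ffunE; suff [a wa] : exists a, w a != w' a.
  by rewrite (bigD1 a) //= mxE (negPf wa) mul0r scaler0.
apply/existsP; rewrite -negb_forall; apply: contra w'w => /forallP ww.
by apply/eqP/ffunP => a; apply/esym/eqP/ww.
Qed.

Lemma tact_unique k g (f : {linear tpow k -> tpow k}) :
  (forall v, f (ptens v) = ptens (fun a => g *m v a)) -> f =1 tact g.
Proof.
move=> fE u; pose h := HB.pack_for {linear tpow k -> tpow k} (@tact k g)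
  (GRing.isLinear.Build _ _ _ _ _ (@tact_is_linear k g)).
rewrite -[tact g u]/(h u) (tpow_decomp u) !linear_sum; apply: eq_bigr => w _.
by rewrite !linearZ /= fE tact_ptens.
Qed.

Lemma invariants_subproof (G : set 'M[C]_2) k :
  exists U : {vspace tpow k},
    forall u, (u \in U) <-> (forall g, G g -> tact g u = u).
Proof.
pose P u := forall g, G g -> @tact k g u = u.
have linP c u v : P u -> P v -> P (c *: u + v).
  by move=> Pu Pv g Gg; rewrite tact_is_linear Pu// Pv.
have P0 : P 0.
  move=> g _; have := @tact_is_linear k g (-1) 0 0.
  by rewrite scaler0 addr0 scaleN1r addNr.
pose A d := `[< exists2 U : {vspace tpow k}, \dim U = d & forall u, u \in U -> P u >].
have A0 : exists d, A d.
  exists 0%N; apply/asboolP; exists 0%VS; first exact: dimv0.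
  by move=> u; rewrite memv0 => /eqP ->.
have Ab d : A d -> (d <= \dim {: tpow k})%N.
  by move=> /asboolP [U <- _]; exact/dimvS/subvf.
case: (ex_maxnP A0 Ab) => d /asboolP [U dU UP] dmax.
exists U => u; split; first exact: UP.
move=> Pu; apply: contrapT => /negP uU.
have : A (\dim (U + <[u]>)).
  apply/asboolP; exists (U + <[u]>)%VS => // _ /memv_addP [x xU [_ /vlineP [c ->] ->]].
  by rewrite addrC; apply: linP => //; exact: UP.
move=> /dmax; rewrite -dU => le_dim; case/negP: uU.
have /eqP -> : (U == U + <[u]>)%VS by rewrite eqEdim addvSl.
exact: (subvP (addvSr U _)) (memv_line u).
Qed.

Definition invariants (G : set 'M[C]_2) (k : nat) : {vspace tpow k} :=
  projT1 (cid (invariants_subproof G k)).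

Lemma invariantsP G k (u : tpow k) :
  (u \in invariants G k) <-> (forall g, G g -> tact g u = u).
Proof. exact: (projT2 (cid (invariants_subproof G k))). Qed.

End TensorPowers.

Section CyclicGroup.
Variable R : realType.

Definition zeta (n : nat) : R[i] :=
  cos (2 * pi / n%:R) +i* sin (2 * pi / n%:R).

Definition zgen (n : nat) : 'M[R[i]]_2 :=
  diag_mx (\row_(i < 2) if i == ord0 then (zeta n)^-1 else zeta n).

Definition cyc (n : nat) : set 'M[R[i]]_2 :=
  [set g | exists j : int, g = zgen n ^ j].

Lemma zetaX n j :
  zeta n ^+ j = cos (2 * pi * j%:R / n%:R) +i* sin (2 * pi * j%:R / n%:R).
Proof.
elim: j => [|j IH]; first by rewrite mulr0 mul0r cos0 sin0.
rewrite exprS IH /zeta -(natr1 j).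
have -> : 2 * pi * (j%:R + 1) / n%:R
  = 2 * pi / n%:R + 2 * pi * j%:R / n%:R :> R by rewrite mulrDr mulr1 mulrDl addrC.
rewrite cosD sinD; apply/eqP; rewrite eq_complex /= eqxx /=.
by rewrite addrC.
Qed.

Lemma zeta_prim n : (0 < n)%N -> n.-primitive_root (zeta n).
Proof.
move=> n0; have nR : (0 : R) < n%:R by rewrite ltr0n.
rewrite /primitive_root_of_unity n0 /=; apply/forallP => i; apply/eqP.
rewrite unity_rootE zetaX; have [->|ni] := eqVneq i.+1 n.
  by rewrite mulfK ?(gt_eqF nR)// mulr_natl cos2pi sin2pi eqxx.
apply/negbTE; rewrite eq_complex /= negb_and; apply/orP; left.
pose x : R := pi * i.+1%:R / n%:R.
have -> : 2 * pi * i.+1%:R / n%:R = x *+ 2 :> R by rewrite /x -[RHS]mulr_natl !mulrA.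
have x0 : 0 < x by rewrite /x divr_gt0// mulr_gt0// pi_gt0.
have xpi : x < pi.
  by rewrite /x ltr_pdivrMr// ltr_pM2l ?pi_gt0// ltr_nat ltn_neqAle ni ltn_ord.
have sx : 0 < sin x by apply: sin_gt0_pi; rewrite x0.
rewrite cos_mulr2n lt_eqF// ltrBlDr -mulr2n ltr_pMn2r//.
by rewrite -(cos2Dsin2 x) ltrDl exprn_gt0.
Qed.

Lemma zetaJ n : zeta n * (zeta n)^* = 1.
Proof.
apply/eqP; rewrite eq_complex /= mulrN opprK -!expr2 cos2Dsin2 eqxx /=.
by rewrite mulrN mulrC addNr.
Qed.

Lemma zeta_neq0 n : zeta n != 0.
Proof. by apply: contra_eq_neq (zetaJ n) => ->; rewrite mul0r eq_sym oner_neq0. Qed.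

Lemma zgen_SU2 n : zgen n \is unitarymx /\ \det (zgen n) = 1.
Proof.
split; last first.
  by rewrite det_diag big_ord_recl big_ord1 !mxE /= mulVf// zeta_neq0.
apply/unitarymxP/matrixP => i j; rewrite mul_diag_mx !mxE.
have [->|ij] := eqVneq i j; last by rewrite mulr0n rmorph0 mulr0.
rewrite mulr1n; case: eqP => _; last exact: zetaJ.
by rewrite fmorphV -invfM zetaJ invr1.
Qed.

(* V is the direct sum of the lines on which zgen n acts as zeta^-1 and zeta. *)
Lemma zgen_V n (v : 'cV_2) :
  zgen n *m v = \col_i ((if i == ord0 then (zeta n)^-1 else zeta n) * v i ord0).
Proof. by apply/matrixP => i j; rewrite mul_diag_mx !mxE (ord1 j). Qed.

Lemma cyc_SU2 n g : cyc n g -> g \is unitarymx /\ \det g = 1.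
Proof.
have [uz dz] := zgen_SU2 n.
have X k : zgen n ^+ k \is unitarymx /\ \det (zgen n ^+ k) = 1.
  elim: k => [|k [uk dk]]; first by rewrite expr0 det1; split => //; apply/unitarymxP; rewrite trmx1 map_mx1 mulmx1.
  by rewrite exprS det_mulmx dz dk mulr1 mul_unitarymx.
case=> -[k|k] ->; first exact: X.
have [uk dk] := X k.+1; rewrite NegzE -exprnN -[_^-1]/(invmx _).
by rewrite det_inv dk invr1 invmx_unitary// trmxC_unitary.
Qed.

End CyclicGroup.

Arguments zeta : clear implicits.
Arguments zgen : clear implicits.
Arguments cyc : clear implicits.

Section PowerSeries.
Variable F : fieldType.

Definition fps := nat -> F.

Definition fps_of_poly (p : {poly F}) : fps := fun k => p`_k.

Definition fps_mul (f g : fps) : fps :=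
  fun k => \sum_(i < k.+1) f i * g (k - i)%N.

Fixpoint fps_div_seq (f g : fps) (k : nat) : seq F :=
  if k is k'.+1 then
    let s := fps_div_seq f g k' in
    rcons s ((f k' - \sum_(i < k') s`_i * g (k' - i)%N) / g 0%N)
  else [::].

(* The quotient of power series, meaningful when g 0 != 0; see fps_divP. *)
Definition fps_div (f g : fps) : fps := fun k => (fps_div_seq f g k.+1)`_k.

Lemma size_fps_div_seq f g k : size (fps_div_seq f g k) = k.
Proof. by elim: k => //= k IH; rewrite size_rcons IH. Qed.

Lemma nth_fps_div_seq f g k i :
  (i < k)%N -> (fps_div_seq f g k)`_i = fps_div f g i.
Proof.
elim: k => // k IH; rewrite ltnS leq_eqVlt => /orP [/eqP -> //|ik].
by rewrite /= nth_rcons size_fps_div_seq ik IH.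
Qed.

Lemma fps_divE f g k :
  fps_div f g k =
  (f k - \sum_(i < k) fps_div f g i * g (k - i)%N) / g 0%N.
Proof.
rewrite {1}/fps_div /= nth_rcons size_fps_div_seq ltnn eqxx.
by congr ((_ - _) / _); apply: eq_bigr => i _; rewrite nth_fps_div_seq.
Qed.

Lemma fps_divP (h f g : fps) :
  g 0%N != 0 -> (h = fps_div f g) <-> (fps_mul h g = f).
Proof.
move=> g0; split=> [->|hg].
  apply/funext => k; rewrite /fps_mul big_ord_recr /= subnn.
  by rewrite [X in _ + X * _]fps_divE divfK// addrC subrK.
apply/funext => k; elim/ltn_ind: k => k IH.
rewrite fps_divE -[X in X k - _]hg /fps_mul big_ord_recr /= subnn.
have -> : \sum_(i < k) fps_div f g i * g (k - i)%N = \sum_(i < k) h i * g (k - i)%N.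
  by apply: eq_bigr => i _; rewrite IH.
by rewrite [X in X / _]addrC addKr mulfK.
Qed.

End PowerSeries.

(* The denominators of the two rational expressions are invertible series. *)
Lemma den_cos_coef0 (R : realType) (n : nat) :
  fps_of_poly (\prod_(0 <= r < n)
    (1 - (2 * cos (2 * pi * r%:R / n%:R)) *: 'X : {poly R})) 0%N = 1.
Proof.
rewrite /fps_of_poly -horner_coef0 horner_prod big1// => r _.
by rewrite !hornerE ?mulr0 ?subr0.
Qed.

Lemma den_binom_coef0 (R : realType) (n : nat) : (0 < n)%N ->
  fps_of_poly ((2 : R) ^ (1 - n%:Z)
      *: (\sum_(0 <= r < (n %/ 2).+1)
            'C(n, 2 * r)%:R *: (1 - 4 *: 'X^2) ^+ r)
    - 2 *: 'X^n : {poly R}) 0%N = 1.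
Proof.
move=> n0; rewrite /fps_of_poly -horner_coef0 !hornerE horner_sum expr0n gtn_eqF// ?mulr0 ?subr0.

rewrite (eq_bigr (fun i => 'C(n, 2 * i)%:R)) => [|i _]; last first.
  by rewrite !hornerE /= !mulr0 subr0 expr1n mulr1.
rewrite -natr_sum.
suff -> : (\sum_(0 <= r < (n %/ 2).+1) 'C(n, 2 * r) = 2 ^ n.-1)%N.
  case: n n0 => // n _.
  have -> : 1 - n.+1%:Z = - n%:Z by rewrite intS opprD addrA subrr add0r.
  by rewrite natrX -exprnN mulVf// expf_neq0// pnatr_eq0.
case: n n0 => // n _ /=.
have E m : (\sum_(0 <= r < m.+1) 'C(n.+1, 2 * r) = \sum_(0 <= i < m.*2.+1) 'C(n, i))%N.
  elim: m => [|m IH]; first by rewrite !big_nat1 !bin0.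
  rewrite big_nat_recr//= IH doubleS !(big_nat_recr _.+1)//= -addnA.
  by rewrite mul2n doubleS binS [('C(n, _.+2) + _)%N]addnC.
have S2 : (\sum_(0 <= i < n.+1) 'C(n, i) = 2 ^ n)%N.
  rewrite big_mkord -[2%N]/(1 + 1)%N expnDn.
  by apply: eq_bigr => i _; rewrite !exp1n !muln1.
rewrite E divn2 -[RHS]S2; have := odd_double_half n.+1.
case: (odd n.+1) => /=; last by rewrite add0n => ->; rewrite big_nat_recr//= bin_small// addn0.
by rewrite add1n => ->.
Qed.

Definition poincare (R : realType) (G : set 'M[R[i]]_2) : fps R :=
  fun k => (\dim (invariants G k))%:R.

(* Main.v *)
(* The basis tensors of V^(tensor k) are eigenvectors of the generator, so the
   invariants have as dimension the number of those with eigenvalue 1, which a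
   root-of-unity filter turns into (1/n) sum_r l_r^k with
   l_r = 2 cos (2 pi r / n). Hence, with D = prod_r (1 - l_r t), the series
   n D m^0 is the sum over r of the products of the remaining factors, that is
   n D - t D'. Put t^2 = a b with a + b = 1: then D = a^n + b^n - 2 t^n, while
   prod_(0 < r < n) (1 - 2 cos (pi r / n) t) = (a^n - b^n) / (a - b). Both are
   expressed by the Chebyshev-like recurrence u_(k+2) = u_(k+1) - t^2 u_k, from
   which n D - t D' = n u_(n-1) and the binomial closed forms follow. *)

From HB Require Import structures.
Require Import Defs.
From mathcomp Require Import all_boot all_order all_algebra.
From mathcomp Require Import all_classical all_reals all_analysis.
From mathcomp Require Import complex ring lra zify.

Import Order.TTheory GRing.Theory Num.Theory.
Local Open Scope ring_scope.

(** * Polynomials defined by the Chebyshev-like recurrence *)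

Section RecurrencePolynomials.
Variable R : realFieldType.

(* [chebU n] is [t ^ n * U_n (1 / (2 t))], with [U_n] the Chebyshev polynomial
   of the second kind. *)
Fixpoint chebU (n : nat) : {poly R} :=
  if n is m.+1 then
    if m is k.+1 then chebU m - 'X^2 * chebU k else 1
  else 1.

Lemma chebUSS n : chebU n.+2 = chebU n.+1 - 'X^2 * chebU n.
Proof. by []. Qed.

(** Induction by Pascal's rule. A larger bound [m] only adds vanishing binomials; this freedom lets
    the sums for [n.+1] and [n] be aligned after the index shift caused by ['X^2]. *)
Lemma chebU_closed n m : (n./2 <= m)%N ->
  chebU n = \sum_(0 <= r < m.+1) ((-1) ^+ r * 'C(n - r, r)%:R) *: 'X^(2 * r).
Proof.
have pad k a b : (k./2 <= a)%N -> (a <= b)%N ->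
  \sum_(0 <= r < b.+1) ((-1) ^+ r * 'C(k - r, r)%:R) *: 'X^(2 * r)
  = \sum_(0 <= r < a.+1) ((-1) ^+ r * 'C(k - r, r)%:R) *: 'X^(2 * r) :> {poly R}.
  move=> ka ab; rewrite (@big_cat_nat _ _ _ a.+1)//= [X in _ + X]big_nat_cond [X in _ + X]big1 ?addr0//.
  by move=> r /andP[/andP[ar _] _]; rewrite bin_small ?mulr0 ?scale0r//; lia.
elim/ltn_ind: n m => -[|[|n]] IH m nm.
- by rewrite (pad 0%N 0%N)// big_nat1 expr0 bin0 mulr1 scale1r muln0 expr0.
- by rewrite (pad 1%N 0%N)// big_nat1 expr0 bin0 mulr1 scale1r muln0 expr0.
case: m nm => [|m] nm; first by [].
rewrite chebUSS (IH n.+1 _ m.+1)//; last by lia.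
rewrite (IH n _ m)//.
rewrite !(big_nat_recl m.+1)//= !bin0 -addrA; congr (_ + _).
rewrite mulr_sumr -sumrB !big_mkord; apply: eq_bigr => -[r rm] _ /=.
have [rn|nr] := leqP r n; last first.
  by rewrite !bin_small ?mulr0 ?scale0r ?mulr0 ?subrr//; lia.
have -> : (n.+2 - r.+1 = (n - r).+1)%N by lia.
have -> : (n.+1 - r.+1 = n - r)%N by lia.
rewrite binS natrD -scalerAr -exprD.
have -> : (2 + 2 * r = 2 * r.+1)%N by lia.
by rewrite -scalerBl exprS; congr (_ *: _); ring.
Qed.

(** For [n > 0] both sides are [-2 (n+1) t^2 u_(n-1)]. The form chosen avoids the index [n - 1] and
    leaves just [(n+1) u_n] when subtracted from [n+1] times the polynomial differentiated. *)
Lemma chebU_deriv n :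
  'X * (2 *: chebU n.+1 - chebU n)^`() =
  n.+1%:R *: (2 *: chebU n.+1 - chebU n - chebU n).
Proof.
elim/ltn_ind: n => -[|[|n]] IH.
- by rewrite /= !poly.derivE; rewrite -!mul_polyC !polyCMn; ring.
- rewrite /= !poly.derivE -!mul_polyC !polyCMn /=; ring.
have := IH n (ltnW (ltnSn _)); have := IH n.+1 (ltnSn _).
have E k : (chebU k.+2)^`() = (chebU k.+1)^`() - 2 * 'X * chebU k - 'X^2 * (chebU k)^`().
  by rewrite chebUSS derivB derivM derivXn /= opprD addrA -mulr_natl.
have D k : (2 *: chebU k.+1 - chebU k)^`() = 2 *: (chebU k.+1)^`() - (chebU k)^`().
  by rewrite derivB derivZ.
rewrite !D !E !chebUSS.
rewrite -!mul_polyC !rmorph_nat.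
move: (chebU n) (chebU n.+1) (chebU n)^`() (chebU n.+1)^`() => a b a' b'.
set m := n%:R : {poly R}.
have -> : n.+1%:R = m + 1 by rewrite -natr1.
have -> : n.+2%:R = m + 2 by rewrite -!natr1 -/m; ring.
have -> : n.+3%:R = m + 3 by rewrite -!natr1 -/m; ring.
move=> /eqP; rewrite -subr_eq0 => /eqP H1 /eqP; rewrite -subr_eq0 => /eqP H2.
apply/eqP; rewrite -subr_eq0; apply/eqP.
(* The difference of the two sides obeys the recurrence of [chebU], so it vanishes because its two
   previous values do. *)
have := congr2 (fun u v => u - 'X^2 * v) H1 H2; rewrite /= mulr0 subr0 => H.
by apply: etrans H; ring.
Qed.

(** Binet's formula: [a] and [b] are the roots of [x^2 - x + t^2], the characteristic polynomial of
    the recurrence. *)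
Lemma chebU_horner (a b t : R) n : a + b = 1 -> a * b = t ^+ 2 ->
  (a - b) * (chebU n).[t] = a ^+ n.+1 - b ^+ n.+1.
Proof.
move=> s p; elim/ltn_ind: n => -[|[|n]] IH.
- by rewrite /= hornerE mulr1 !expr1.
- by rewrite /= hornerE mulr1 subr_sqr s mulr1.
rewrite chebUSS !hornerE mulrBr mulrCA !IH// -p !exprS.
have -> : b = 1 - a by rewrite -s; ring.
ring.
Qed.

Lemma chebT_horner (a b t : R) n : a + b = 1 -> a * b = t ^+ 2 -> a != b ->
  (2 *: chebU n.+1 - chebU n).[t] = a ^+ n.+1 + b ^+ n.+1.
Proof.
move=> s p ab; have d0 : a - b != 0 by rewrite subr_eq0.
apply: (mulfI d0); rewrite !hornerE mulrBr mulrCA !(chebU_horner _ _ _ _ s p) !exprS.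
have -> : b = 1 - a by rewrite -s; ring.
ring.
Qed.

Lemma poly_eq_small (p q : {poly R}) :
  (forall t : R, 0 < t -> 2 * t < 1 -> p.[t] = q.[t]) -> p = q.
Proof.
move=> pq; apply/eqP; rewrite -subr_eq0; apply: contraT => d0.
(* The points [1 / (i + 3)] are distinct and satisfy [2 t < 1]; their number exceeds the degree of
   [p - q] by one. *)
pose s := [seq (i.+3%:R : R)^-1 | i <- iota 0 (size (p - q))].
have : (size s < size (p - q)%R)%N.
  apply: max_poly_roots d0 _ _.
  - apply/allP => _ /mapP[i _ ->]; rewrite rootE !hornerE pq ?subrr//.
    by rewrite ltr_pdivrMr ?ltr0n// mul1r ltr_nat.
  - rewrite map_inj_uniq ?iota_uniq// => i j /invr_inj /eqP.
    by rewrite eqr_nat => /eqP [].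
by rewrite size_map size_iota ltnn.
Qed.

End RecurrencePolynomials.
(** The factorisation of [X^n - 1], evaluated at [x / y] and homogenised. *)
Lemma prod_sub_prim_root (F : fieldType) n (z x y : F) : n.-primitive_root z ->
  y != 0 -> \prod_(0 <= i < n) (x - z ^+ i * y) = x ^+ n - y ^+ n.
Proof.
move=> zn y0; transitivity (y ^+ n * (('X^n - 1 : {poly F}).[x / y])).
  rewrite -(factor_Xn_sub_1 zn) horner_prod big_mkord -[n in y ^+ n]card_ord.
  rewrite -prodr_const big_mkord -big_split /=; apply: eq_bigr => i _.
  by rewrite !hornerE mulrBr mulrCA divff// mulr1 mulrC.
by rewrite !hornerE mulrBr mulr1 expr_div_n mulrCA divff ?expf_neq0// mulr1.
Qed.

Lemma sum_binom_even (R : comNzRingType) n (s : R) :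
  (1 + s) ^+ n + (1 - s) ^+ n =
  2 * \sum_(0 <= r < (n %/ 2).+1) 'C(n, 2 * r)%:R * (s ^+ 2) ^+ r.
Proof.
have E (x : R) m : (n < m)%N -> (1 + x) ^+ n = \sum_(0 <= i < m) 'C(n, i)%:R * x ^+ i.
  move=> nm; rewrite exprDn -(big_mkord xpredT (fun i => 1 ^+ (n - i) * x ^+ i *+ 'C(n, i))).
  rewrite [RHS](@big_cat_nat _ _ _ n.+1)//= [X in _ + X]big_nat_cond.
  rewrite [X in _ + X]big1 ?addr0 => [|i /andP[/andP[ni _] _]].
    by apply: eq_bigr => i _; rewrite expr1n mul1r mulr_natl.
  by rewrite bin_small// mul0r.
(* Padding to an even number of terms lets the induction add an even and an odd index at a time; the
   odd powers of [s] cancel. *)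
have nm : (n < 2 * (n %/ 2).+1)%N by lia.
rewrite !(E _ _ nm) -big_split /=; elim: (n %/ 2).+1 => [|m IH].
  by rewrite muln0 !big_geq// mulr0.
have -> : (2 * m.+1 = (2 * m).+2)%N by lia.
rewrite !big_nat_recr //= IH -addrA mulrDr; congr (_ + _).
have e : (- s) ^+ (2 * m) = s ^+ (2 * m) by rewrite !exprM sqrrN.
by rewrite [s ^+ _.+1]exprS [(- s) ^+ _.+1]exprS e -exprM; ring.
Qed.

(** * Products of cosine factors through roots of unity *)

Section TrigonometricProducts.
Variable R : realType.
Local Notation C := (R[i]%C).

Lemma zetaV n : (zeta R n)^-1 = (zeta R n)^*.
Proof. by rewrite -[LHS]mulr1 -(zetaJ R n) mulKf// zeta_neq0. Qed.

Lemma zetaXD n r :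
  zeta R n ^+ r + (zeta R n)^-1 ^+ r = (2 * cos (2 * pi * r%:R / n%:R))%:C%C.
Proof.
rewrite zetaV -rmorphXn zetaX; apply/eqP; rewrite eq_complex /= addrN eqxx andbT.
by rewrite -mulr2n [eqbRHS]mulr_natl.
Qed.

(* [a] and [b] are the values [y / (y + 1 / y)] and [y^-1 / (y + 1 / y)] for
   [t = 1 / (y + 1 / y)], a substitution that splits each cosine factor. *)
Lemma zeta_factor n r (a b t : R) : a + b = 1 -> a * b = t ^+ 2 ->
  (a%:C%C - zeta R n ^+ r * t%:C%C) * (a%:C%C - (zeta R n)^-1 ^+ r * t%:C%C)
  = (a * (1 - (2 * cos (2 * pi * r%:R / n%:R)) * t))%:C%C.
Proof.
move=> s p; have b1 : b = 1 - a by rewrite -s; ring.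
set c := cos _; have -> : a * (1 - 2 * c * t) = a ^+ 2 + t ^+ 2 - 2 * c * (a * t).
  by rewrite -p b1; ring.
rewrite /c rmorphB rmorphD !rmorphXn rmorphM /= -zetaXD rmorphM /=.
have z1 : zeta R n ^+ r * (zeta R n)^-1 ^+ r = 1.
  by rewrite -exprMn divff ?zeta_neq0 ?expr1n.
by rewrite -[X in _ + X - _]mul1r -z1; ring.
Qed.

(** Each factor times [a] splits into two conjugate linear factors. Powers of [zeta] and of its
    inverse both run through all n-th roots of unity, so [a^n - t^n] appears twice. *)
Lemma prod_cos_horner n (a b t : R) : (0 < n)%N ->
  a + b = 1 -> a * b = t ^+ 2 -> t != 0 ->
  a ^+ n * (\prod_(0 <= r < n)
     (1 - (2 * cos (2 * pi * r%:R / n%:R)) *: 'X : {poly R})).[t]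
  = (a ^+ n - t ^+ n) ^+ 2.
Proof.
move=> n0 s p t0; apply: complexI.
have t0' : t%:C%C != 0 :> C by rewrite fmorph_eq0.
have zn := zeta_prim R n0.
have zVn : n.-primitive_root (zeta R n)^-1 by rewrite zetaV fmorph_primitive_root.
rewrite rmorphXn rmorphB !rmorphXn /= expr2.
rewrite -{1}(prod_sub_prim_root _ _ _ _ _ zn t0').
rewrite -(prod_sub_prim_root _ _ _ _ _ zVn t0').
have -> : a ^+ n = \prod_(0 <= r < n) a by rewrite prodr_const_nat subn0.
rewrite horner_prod -[in LHS]big_split -[RHS]big_split rmorph_prod.
apply: eq_bigr => r _ /=.
by rewrite (zeta_factor _ _ _ _ _ s p) !hornerE.
Qed.

(** The right side is a product over all 2n-th roots of unity. The roots 1 and -1 contribute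
    [a^2 - t^2]; the others pair off with their inverses. *)
Lemma prod_half_cos_horner n (a b t : R) : (0 < n)%N ->
  a + b = 1 -> a * b = t ^+ 2 -> t != 0 ->
  a ^+ n.-1 * (\prod_(1 <= r < n)
     (1 - (2 * cos (pi * r%:R / n%:R)) *: 'X : {poly R})).[t] * (a ^+ 2 - t ^+ 2)
  = a ^+ (2 * n) - t ^+ (2 * n).
Proof.
case: n => // n _ s p t0; apply: complexI.
have t0' : t%:C%C != 0 :> C by rewrite fmorph_eq0.
have n20 : (0 < 2 * n.+1)%N by lia.
have zn := zeta_prim R n20; set z := zeta R (2 * n.+1) in zn.
have zN : z ^+ n.+1 = -1.
  rewrite /z zetaX.
  have -> : 2 * pi * n.+1%:R / (2 * n.+1)%:R = pi :> R.
    by rewrite natrM; field; rewrite nat1r pnatr_eq0.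
  by rewrite cospi sinpi; apply/eqP; rewrite eq_complex /= oppr0 !eqxx.
rewrite rmorphB !rmorphXn /= -(prod_sub_prim_root _ _ _ _ _ zn t0').
rewrite [RHS](@big_cat_nat _ _ _ n.+1)//; last by lia.
rewrite [X in _ = X * _]big_nat_recl// [X in _ = _ * X]big_ltn; last by lia.
rewrite zN expr0 mul1r mulN1r opprK.
(* Read backwards, the roots after -1 are the inverses of those before it. *)
have -> : \prod_(n.+2 <= i < 2 * n.+1) (a%:C%C - z ^+ i * t%:C%C) =
  \prod_(0 <= i < n) (a%:C%C - z^-1 ^+ i.+1 * t%:C%C) :> C.
  rewrite big_nat_rev /= -{1}[n.+2]add0n big_addn.
  have -> : (2 * n.+1 - n.+2 = n)%N by lia.
  rewrite !big_mkord; apply: eq_bigr => -[i /= ni] _; congr (_ - _ * _).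
  have -> : (n.+2 + 2 * n.+1 - (i + n.+2).+1 = 2 * n.+1 - i.+1)%N by lia.
  rewrite expfB_cond ?(prim_expr_order zn) ?mul1r ?exprVn//.
  by rewrite (negbTE (zeta_neq0 R _)); lia.
rewrite horner_prod big_add1 [LHS]rmorphM [RHS]mulrACA [RHS]mulrC /=.
congr (_ * _); last by rewrite rmorphB !rmorphXn /=; ring.
have -> : a ^+ n = \prod_(0 <= i < n) a by rewrite prodr_const_nat subn0.
rewrite -[in LHS]big_split -[RHS]big_split rmorph_prod.
apply: eq_bigr => i _ /=; rewrite (zeta_factor _ _ _ _ _ s p) !hornerE.
congr ((_ * (1 - 2 * cos _ * _))%:C%C).
by rewrite natrM; field; rewrite nat1r pnatr_eq0.
Qed.

End TrigonometricProducts.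

(** * Closed forms of the numerator and the denominator *)

Section ClosedForms.
Variable R : realType.

Lemma quadratic_roots (t : R) : 0 < t -> 2 * t < 1 ->
  exists a b : R, [/\ a + b = 1, a * b = t ^+ 2, b < a & 0 < a].
Proof.
move=> t0 t1; have d0 : 0 < 1 - 4 * t ^+ 2 by nra.
have s0 : 0 < Num.sqrt (1 - 4 * t ^+ 2) by rewrite sqrtr_gt0.
have s2 := sqr_sqrtr (ltW d0); set s := Num.sqrt _ in s0 s2.
exists ((1 + s) / 2), ((1 - s) / 2); split; [by field| |lra|lra].
have -> : (1 + s) / 2 * ((1 - s) / 2) = (1 - s ^+ 2) / 4 by field.
by rewrite s2; field.
Qed.

(** Since [t^(2N) = a^N b^N], [(a^N - t^N)^2 = a^N (a^N + b^N - 2 t^N)] for [N = n+1]. *)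
Lemma prod_cosE n :
  \prod_(0 <= r < n.+1) (1 - (2 * cos (2 * pi * r%:R / n.+1%:R)) *: 'X : {poly R})
  = 2 *: chebU R n.+1 - chebU R n - 2 *: 'X^(n.+1).
Proof.
apply: poly_eq_small => t t0 t1.
have [a [b [s p ba a0]]] := quadratic_roots _ t0 t1.
apply: (mulfI (expf_neq0 n.+1 (lt0r_neq0 a0))).
rewrite (prod_cos_horner _ _ _ _ _ _ s p) ?gt_eqF//.
rewrite hornerD (chebT_horner _ _ _ _ _ s p) ?gt_eqF// !hornerE.
rewrite mulrBr mulrDr -[a ^+ _ * b ^+ _]exprMn p -exprM mulnC exprM; ring.
Qed.

(** From [a b = t^2] come [a^2 - t^2 = a (a - b)] and, for [N = n+1],
    [a^(2N) - t^(2N) = a^N (a^N - b^N)]; the nonzero common factors cancel. *)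
Lemma prod_half_cosE n :
  \prod_(1 <= r < n.+1) (1 - (2 * cos (pi * r%:R / n.+1%:R)) *: 'X : {poly R})
  = chebU R n.
Proof.
apply: poly_eq_small => t t0 t1.
have [a [b [s p ba a0]]] := quadratic_roots _ t0 t1.
have an := expf_neq0 n (lt0r_neq0 a0).
have d0 : a - b != 0 by rewrite subr_eq0 gt_eqF.
apply: (mulfI an); apply: (mulIf (mulf_neq0 (lt0r_neq0 a0) d0)).
have -> : a * (a - b) = a ^+ 2 - t ^+ 2 by rewrite -p; ring.
rewrite (prod_half_cos_horner _ n.+1 _ _ _ isT s p) ?gt_eqF//.
have -> : a ^+ 2 - t ^+ 2 = a * (a - b) by rewrite -p; ring.
have -> : a ^+ n * (chebU R n).[t] * (a * (a - b)) =
  a ^+ n.+1 * ((a - b) * (chebU R n).[t]) by rewrite exprS; ring.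
rewrite (chebU_horner _ _ _ _ _ s p) mulrBr -[a ^+ _ * b ^+ _]exprMn p -!exprM -exprD.
by rewrite addnn mul2n.
Qed.

(** Take [s = a - b] in [sum_binom_even]: then [1 + s = 2 a], [1 - s = 2 b] and
    [s^2 = 1 - 4 t^2]. *)
Lemma chebT_closed n :
  (2 : R) ^ (1 - n.+1%:Z) *: (\sum_(0 <= r < (n.+1 %/ 2).+1)
    'C(n.+1, 2 * r)%:R *: (1 - 4 *: 'X^2) ^+ r)
  = 2 *: chebU R n.+1 - chebU R n.
Proof.
apply: poly_eq_small => t t0 t1.
have [a [b [s p ba a0]]] := quadratic_roots _ t0 t1.
rewrite (chebT_horner _ _ _ _ _ s p) ?gt_eqF//.
have b1 : b = 1 - a by rewrite -s; ring.
have := sum_binom_even _ n.+1 (a - b).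
have -> : 1 + (a - b) = 2 * a by rewrite b1; ring.
have -> : 1 - (a - b) = 2 * b by rewrite b1; ring.
have -> : (a - b) ^+ 2 = 1 - 4 * t ^+ 2 by rewrite -p b1; ring.
rewrite !exprMn -mulrDr => E.
have -> : 1 - n.+1%:Z = - n%:Z by rewrite intS opprD addrA subrr add0r.
have n2 : (2 : R) ^+ n.+1 != 0 by rewrite expf_neq0// pnatr_eq0.
have e : (2 : R) ^+ n.+1 / 2 ^+ n = 2.
  by rewrite exprS mulfK// expf_neq0// pnatr_eq0.
apply: (mulfI n2); rewrite E hornerZ -exprnN mulrA e.
by congr (_ * _); rewrite horner_sum; apply: eq_bigr => r _; rewrite !hornerE.
Qed.

(** By Leibniz' rule, since each factor [f] satisfies [f - X f' = 1]. Factors are deleted by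
    position, so repeated values [c i] cause no trouble. *)
Lemma deriv_prod_linear (I : Type) (r : seq I) (c : I -> R) :
  \prod_(i <- r) (1 - c i *: 'X) *+ size r
  - 'X * (\prod_(i <- r) (1 - c i *: 'X))^`()
  = \sum_(0 <= k < size r)
      \prod_(i <- take k r ++ drop k.+1 r) (1 - c i *: 'X) :> {poly R}.
Proof.
elim: r => [|x r IH]; first by rewrite big_nil big_geq// derivC mulr0 subr0.
rewrite big_nat_recl//= drop0 big_cons.
under [X in _ = _ + X]eq_bigr do rewrite big_cons.
rewrite -mulr_sumr -IH derivM derivB derivC derivZ derivX -!mul_polyC mulrS /=.
by rewrite -mulrnAr; ring.
Qed.

End ClosedForms.

(** * Generating functions of power sums *)

Section PoincareSeries.
Variable R : realType.

Lemma fps_mul_geometric (c : R) (q : {poly R}) :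
  fps_mul (fun k => c ^+ k) (fps_of_poly ((1 - c *: 'X) * q)) = fps_of_poly q.
Proof.
apply/funext => k; rewrite /fps_mul /fps_of_poly; elim: k => [|k IH].
  by rewrite big_ord1 mul1r mulrBl mul1r -scalerAl coefB coefZ coefXM mulr0 subr0.
rewrite big_ord_recl expr0 mul1r subn0.
under eq_bigr do rewrite /= exprS subSS -mulrA.
rewrite -mulr_sumr IH mulrBl mul1r -scalerAl coefB coefZ coefXM /=.
by rewrite subrK.
Qed.

(** A form of Newton's identities: each geometric series cancels its own factor of the product. *)
Lemma power_sums_mul_prod n (c : nat -> R) :
  fps_mul (fun k => \sum_(0 <= r < n) c r ^+ k)
    (fps_of_poly (\prod_(0 <= r < n) (1 - c r *: 'X)))
  = fps_of_poly (\prod_(0 <= r < n) (1 - c r *: 'X) *+ n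
      - 'X * (\prod_(0 <= r < n) (1 - c r *: 'X))^`()).
Proof.
have := deriv_prod_linear R _ (index_iota 0 n) c.
rewrite size_iota subn0 => ->; apply/funext => k.
rewrite /fps_mul [RHS]coef_sum.
under [LHS]eq_bigr do rewrite mulr_suml.
rewrite exchange_big /= big_nat_cond [RHS]big_nat_cond; apply: eq_bigr => r.
rewrite andbT => /andP[_ rn].
rewrite -[RHS]/(fps_of_poly _ k) -[in RHS](fps_mul_geometric (c r)) /fps_mul.
apply: eq_bigr => i _; congr (_ * fps_of_poly _ _).
have sz : size (index_iota 0 n) = n by rewrite size_iota subn0.
(* Reinserts the deleted [r]-th factor. *)
rewrite -{1}(cat_take_drop r (index_iota 0 n)) (drop_nth 0%N) ?sz//.
rewrite nth_iota ?subn0// add0n !big_cat big_cons /=; ring.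
Qed.

End PoincareSeries.
(** Extension by zero embeds the functions on the subtype of [S] with image [U]. *)
Lemma dim_support (F : fieldType) (T : finType) (S : pred T)
    (U : {vspace {ffun T -> F^o}}) :
  (forall u, u \in U <-> (forall t, ~~ S t -> u t = 0)) -> \dim U = #|S|.
Proof.
move=> US; pose g (v : {ffun {t | S t} -> F^o}) : {ffun T -> F^o} :=
  [ffun t => oapp v 0 (insub t)].
have g_lin : linear g.
  move=> c u v; apply/ffunP => t; rewrite !ffunE.
  by case: insubP => [s _ _|_] /=; rewrite ?ffunE // scaler0 addr0.
pose gl := HB.pack_for {linear {ffun {t | S t} -> F^o} -> {ffun T -> F^o}} g
  (GRing.isLinear.Build _ _ _ _ _ g_lin).
have gE v : linfun gl v = g v by rewrite lfunE.
have -> : U = limg (linfun gl).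
  apply/vspaceP => u; apply/idP/memv_imgP => [/US uS|[v _ ->]]; last first.
    by apply/US => t /negPf St; rewrite gE ffunE insubF.
  exists [ffun s => u (val s)]; first exact: memvf.
  apply/ffunP => t; rewrite gE ffunE; case: insubP => [s _ <-|/uS ->//].
  by rewrite /= ffunE.
rewrite limg_dim_eq; last first.
  apply/eqP; rewrite -subv0; apply/subvP => v /memv_capP[_].
  rewrite memv_ker memv0 gE => /eqP gv; apply/eqP/ffunP => s.
  have := congr1 (fun u : {ffun T -> F^o} => u (val s)) gv.
  by rewrite !ffunE valK.
by rewrite dimvf /dim /= muln1 card_sig.
Qed.

(** * Action of matrices on tensor powers *)

Section TensorAction.
Variables (F : fieldType) (k : nat).
Implicit Types (u : tpow F k) (g h : 'M[F]_2).

Lemma tact_mul g h u : tact (g * h) u = tact g (tact h u).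
Proof.
apply/ffunP => w; rewrite !ffunE.
under [RHS]eq_bigr do rewrite ffunE mulr_sumr.
rewrite exchange_big /=; apply: eq_bigr => w' _.
under [RHS]eq_bigr do rewrite mulrA -big_split /=.
rewrite -mulr_suml -(bigA_distr_bigA (fun a j => g (w a) j * h j (w' a))) /=.
by congr (_ * _); apply: eq_bigr => a _; rewrite mxE.
Qed.

Lemma tact_diag (d : 'rV[F]_2) u w :
  tact (diag_mx d) u w = (\prod_(a < k) d ord0 (w a)) * u w.
Proof.
rewrite ffunE (bigD1 w)//= [X in _ + X]big1 ?addr0 => [|w' w'w].
  by congr (_ * _); apply: eq_bigr => a _; rewrite mxE eqxx mulr1n.
have [a wa] : exists a, w a != w' a.
  apply/existsP; rewrite -negb_forall; apply: contra w'w => /forallP ww.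
  by apply/eqP/ffunP => a; apply/esym/eqP/ww.
by rewrite (bigD1 a)//= mxE (negPf wa) mulr0n !mul0r.
Qed.

Lemma tact1 u : tact 1 u = u.
Proof.
apply/ffunP => w; rewrite -[1]/(1%:M) -diag_const_mx tact_diag.
by rewrite big1 ?mul1r// => a _; rewrite mxE.
Qed.

Lemma tact_exprz g u (j : int) : g \is a GRing.unit ->
  tact g u = u -> tact (g ^ j) u = u.
Proof.
move=> gU gu; have X i : tact (g ^+ i) u = u.
  by elim: i => [|i IH]; rewrite ?tact1// exprS tact_mul IH.
case: j => i; first exact: X.
by rewrite NegzE -exprnN -[in LHS](X i.+1) -tact_mul mulVr ?tact1// unitrX.
Qed.

End TensorAction.

Lemma sum_root_of_unity (F : fieldType) n (x : F) : x ^+ n = 1 ->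
  \sum_(0 <= r < n) x ^+ r = if x == 1 then n%:R else 0.
Proof.
move=> xn; have [->|x1] := eqVneq x 1.
  under eq_bigr do rewrite expr1n.
  by rewrite sumr_const_nat subn0.
have := subrX1 x n; rewrite xn subrr -(big_mkord xpredT (fun i => x ^+ i)).
by move=> /esym/eqP; rewrite mulf_eq0 subr_eq0 (negPf x1) => /eqP.
Qed.

(** * Dimensions of the invariants of the cyclic group *)

Section CyclicInvariants.
Variables (R : realType) (n : nat).
Hypothesis n_gt0 : (0 < n)%N.

Let eigen (j : 'I_2) : R[i]%C := if j == ord0 then (zeta R n)^-1 else zeta R n.
Let weight k (w : {ffun 'I_k -> 'I_2}) := \prod_(a < k) eigen (w a).

Let tact_zgen k (u : tpow R[i]%C k) w : tact (zgen R n) u w = weight k w * u w.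
Proof. by rewrite tact_diag; congr (_ * _); apply: eq_bigr => a _; rewrite mxE. Qed.

(** The generator acts diagonally on the basis tensors, and what it fixes is fixed by all its
    integer powers. *)
Let mem_invariants k (u : tpow R[i]%C k) :
  u \in invariants (cyc R n) k <-> (forall w, weight k w != 1 -> u w = 0).
Proof.
rewrite invariantsP; split => [inv w w1|u0 _ [j ->]].
  have /ffunP/(_ w) : tact (zgen R n) u = u by apply: inv; exists 1; rewrite expr1z.
  rewrite tact_zgen => /eqP; rewrite -subr_eq0 -{2}[u w]mul1r -mulrBl mulf_eq0.
  by rewrite subr_eq0 (negPf w1) => /eqP.
apply: tact_exprz; first by rewrite unitmxE (zgen_SU2 R n).2 unitr1.
apply/ffunP => w; rewrite tact_zgen; have [->|/u0 ->] := eqVneq (weight k w) 1.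
  by rewrite mul1r.
by rewrite mulr0.
Qed.

Lemma dim_invariants_cyc k :
  n%:R * poincare (cyc R n) k =
  \sum_(0 <= r < n) (2 * cos (2 * pi * r%:R / n%:R)) ^+ k :> R.
Proof.
rewrite /poincare (dim_support _ _ (fun w => weight k w == 1) _ (@mem_invariants k)).
apply: complexI; rewrite rmorphM !rmorph_nat rmorph_sum /=.
have zn := prim_expr_order (zeta_prim R n_gt0).
have weightX w : weight k w ^+ n = 1.
  rewrite /weight -prodrXl big1// => a _; rewrite /eigen.
  by case: ifP; rewrite ?exprVn zn ?invr1.
(* Weights are n-th roots of unity, so the inner sum is [n] at weight 1 and zero elsewhere. *)
transitivity (\sum_w \sum_(0 <= r < n) weight k w ^+ r).
  under eq_bigr do rewrite sum_root_of_unity//.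
  by rewrite -big_mkcond /= sumr_const mulr_natr.
rewrite exchange_big /=; apply: eq_bigr => r _.
under eq_bigr do rewrite /weight -prodrXl.
(* The sum over all words factors into [k] equal sums over the two eigenvalues. *)
rewrite -(bigA_distr_bigA (fun (_ : 'I_k) j => eigen j ^+ r)) /=.
rewrite prodr_const card_ord big_ord_recl big_ord1 rmorphXn /=.
by rewrite -zetaXD addrC.
Qed.

End CyclicInvariants.

Theorem theorem3p23 (R : realType) (n : nat) (hn : (3 <= n)%N) :
  poincare (cyc R n) =
    fps_div
      (fps_of_poly
        (\prod_(1 <= r < n) (1 - (2 * cos (pi * r%:R / n%:R)) *: 'X : {poly R})))
      (fps_of_poly
        (\prod_(0 <= r < n) (1 - (2 * cos (2 * pi * r%:R / n%:R)) *: 'X : {poly R})))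
  /\
  fps_div
      (fps_of_poly
        (\prod_(1 <= r < n) (1 - (2 * cos (pi * r%:R / n%:R)) *: 'X : {poly R})))
      (fps_of_poly
        (\prod_(0 <= r < n) (1 - (2 * cos (2 * pi * r%:R / n%:R)) *: 'X : {poly R})))
  =
    fps_div
      (fps_of_poly
        (\sum_(0 <= r < ((n - 1) %/ 2).+1)
           ((-1) ^+ r * 'C(n - 1 - r, r)%:R) *: 'X^(2 * r) : {poly R}))
      (fps_of_poly
        ((2 : R) ^ (1 - n%:Z)
           *: (\sum_(0 <= r < (n %/ 2).+1)
                 'C(n, 2 * r)%:R *: (1 - 4 *: 'X^2) ^+ r)
         - 2 *: 'X^n : {poly R})).
Proof.
(* From here on the group has order [n.+1]. *)
case: n hn => // n _; split.
  apply/fps_divP; first by rewrite den_cos_coef0 oner_neq0.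
  have nz : n.+1%:R != 0 :> R by rewrite pnatr_eq0.
  apply/funext => k; apply: (mulfI nz).
  have := congr1 (fun f => f k)
    (power_sums_mul_prod R n.+1 (fun r => 2 * cos (2 * pi * r%:R / n.+1%:R))).
  rewrite prod_half_cosE /= {1 2}/fps_mul mulr_sumr => E.
  under [LHS]eq_bigr do rewrite mulrA dim_invariants_cyc//.
  rewrite E prod_cosE /fps_of_poly -coefZ; congr ((_ : {poly R})`_k).
  (* The monomial [2 t^(n+1)] drops out, as [t d/dt] multiplies it by [n+1]. *)
  rewrite derivB mulrBr chebU_deriv derivZ derivXn !scaler_nat exprS /=.
  by move: (chebU R n.+1) (chebU R n) => p q; ring.
rewrite prod_half_cosE prod_cosE chebT_closed; congr fps_div.
by rewrite subn1 /= divn2 -chebU_closed.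
Qed.
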